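(* There exist (absolute) constants $b$ and $c$ such that for all distinct primes $t$, $q$, $r$, every power $s$ of $t$, and every integer $\alpha>1$, the number of conjugacy classes (in ${\rm GL}(\alpha,s)$) of subgroups that are maximal amongst the subgroups of ${\rm GL}(\alpha, s)$ which are in $\mathfrak{A}_q\mathfrak{A}_r$ is at most $$2^{(b+c) (\alpha^2/\sqrt{\log (\alpha)}) + (5/6) \alpha \log (\alpha) + \alpha (1+ \log(6))}\, s^{(3+c)\alpha^2}.$$
   Context: $\log$ denotes the logarithm to base $2$. ${\rm GL}(\alpha,s)$ is the group of invertible $\alpha\times\alpha$ matrices over the field $\mathbb{F}_s$ with $s$ elements. For distinct primes $q,r$, $\mathfrak{A}_q\mathfrak{A}_r$ is the variety of all groups $G$ having an abelian normal subgroup $N$ of exponent dividing $q$ such that $G/N$ is abelian of exponent dividing $r$. Maximality is with respect to inclusion in the set of all subgroups of ${\rm GL}(\alpha,s)$ that belong to $\mathfrak{A}_q\mathfrak{A}_r$. *)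

(* Defs.v *)
From HB Require Import structures.
From mathcomp Require Import all_boot all_order all_algebra.
From mathcomp Require Import all_fingroup abelian.
From mathcomp Require Import reals exp.

Set Implicit Arguments.
Unset Strict Implicit.
Unset Printing Implicit Defensive.

Import Order.TTheory GRing.Theory Num.Theory.

Local Open Scope group_scope.

Definition log2 (R : realType) (x : R) : R := (ln x / ln 2)%R.

(* Membership of a finite group in the product variety A_q A_r. *)
Definition in_AqAr (q r : nat) (gT : finGroupType) (G : {group gT}) : bool :=
  [exists N : {group gT},
    [&& N <| G, abelian N, (exponent N %| q)%N,
        abelian (G / N) & (exponent (G / N) %| r)%N]].

Definition max_AqAr (q r : nat) (gT : finGroupType) (G M : {group gT}) : bool :=
  [max M of H | (H \subset G) && in_AqAr q r H].

(* M :^: G is the set of all G-conjugates of M, so this is a set of conjugacy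
   classes of subgroups. *)
Definition max_AqAr_classes (q r : nat) (gT : finGroupType) (G : {group gT}) :
    {set {set {set gT}}} :=
  [set (M : {set gT}) :^: G | M : {group gT} & max_AqAr q r G M].

(* Main.v *)
(* A group in A_q A_r is N B with N elementary abelian of exponent q and B
   elementary abelian of exponent r (Schur-Zassenhaus), so it is enough to bound
   the number of elementary abelian p-subgroups of GL_n(F) by a power
   |F|^(C n^2), for p different from the characteristic.  Such a subgroup is
   simultaneously diagonalizable over the algebraic closure, hence is generated
   by n elements, and up to conjugation it lies in a fixed Sylow p-subgroup S.
   This leaves at most |GL_n(F)| |S|^n of them, and lifting the exponent in the
   order formula for GL_n(F) yields |S| <= |F|^(4 n).  The total is
   |F|^(10 n^2), so b = 0 and c = 7 will do. *)

Require Import Defs.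
From HB Require Import structures.
From mathcomp Require Import all_boot all_order all_algebra.
From mathcomp Require Import all_fingroup all_solvable all_field abelian.
From mathcomp Require Import reals exp ring.

Set Implicit Arguments.
Unset Strict Implicit.
Unset Printing Implicit Defensive.

Import Order.TTheory GRing.Theory Num.Theory.

(** * Lifting the exponent: valuations of geometric sums and of powers minus one *)

(** Every power of [d.+1] is 1 modulo [q], so the sum is [u] modulo [q]. *)
Lemma logn_geometric_sum_eq0 q d u : prime q -> q %| d -> ~~ (q %| u) ->
  logn q (\sum_(i < u) d.+1 ^ i) = 0.
Proof.
move=> q_pr qd qu; apply/eqP; rewrite lognE q_pr /=; case: ifP => // /andP[_].
rewrite /dvdn -modn_summ (eq_bigr (fun=> 1 %% q)) => [|i _].
  rewrite modn_summ sum_nat_const card_ord muln1.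
  by rewrite -/(dvdn q u) (negPf qu).
by rewrite -modnXm -addn1 -modnDml (eqP qd) modnXm exp1n.
Qed.

(** Modulo [q ^ 2] the i-th term is [i * d + 1], so the sum is ['C(q, 2) * d + q]. The first summand
    vanishes: an odd [q] divides ['C(q, 2)], and for [q = 2] one uses [4 %| d]. *)
Lemma logn_geometric_sum_le1 q d : prime q -> q %| d -> (q = 2 -> 4 %| d) ->
  logn q (\sum_(i < q) d.+1 ^ i) <= 1.
Proof.
move=> q_pr qd q2; have q_gt0 := prime_gt0 q_pr; have q_gt1 := prime_gt1 q_pr.
have powE i : d.+1 ^ i = i * d + 1 %[mod q ^ 2].
  elim: i => // i IHi; rewrite expnSr -modnMml IHi modnMml.
  have ->: (i * d + 1) * d.+1 = i * (d * d) + (i.+1 * d + 1).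
    by rewrite mulnS mulnDl mulSn -mulnA; ring.
  rewrite -modnDml.
  by have/eqP->: q ^ 2 %| i * (d * d) by rewrite dvdn_mull // dvdn_mul.
have dvd_bin : q ^ 2 %| 'C(q, 2) * d.
  have [q2' | qn2] := eqVneq q 2; first by rewrite q2' dvdn_mull // q2.
  by rewrite dvdn_mul // prime_dvd_bin //= ltn_neqAle eq_sym qn2.
have geomE : \sum_(i < q) d.+1 ^ i = q %[mod q ^ 2].
  rewrite -modn_summ (eq_bigr (fun i : 'I_q => (i * d + 1) %% q ^ 2)); last first.
    by move=> i _; apply: powE.
  rewrite modn_summ big_split /= -big_distrl /= sum_nat_const card_ord muln1.
  by rewrite -(big_mkord xpredT (fun i => i)) bin2_sum -modnDml (eqP dvd_bin).
rewrite leqNgt; apply/negP => lt1.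
have: q ^ 2 %| \sum_(i < q) d.+1 ^ i.
  exact: dvdn_trans (dvdn_exp2l q lt1) (pfactor_dvdnn _ _).
rewrite /dvdn geomE modn_small ?(eqn0Ngt, q_gt0) //.
by rewrite -[ltnLHS](expn1 q) ltn_exp2l.
Qed.

(* One half of the lifting-the-exponent lemma. *)
Lemma logn_predX_le q d j : prime q -> 0 < d -> q %| d -> (q = 2 -> 4 %| d) ->
  0 < j -> logn q (d.+1 ^ j).-1 <= logn q d + logn q j.
Proof.
move=> q_pr d_gt0 qd q2; elim/ltn_ind: j => j IHj j_gt0.
have geom_gt0 (a m : nat) : 0 < m -> 0 < \sum_(i < m) a.+1 ^ i.
  by case: m => // m _; rewrite big_ord_recl.
have [/dvdnP[k Dj]|qj] := boolP (q %| j); last first.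
  by rewrite predn_exp lognM ?geom_gt0 // logn_geometric_sum_eq0 // addn0 leq_addr.
have k_gt0 : 0 < k by move: j_gt0; rewrite Dj muln_gt0 => /andP[].
have kj : k < j by rewrite Dj ltn_Pmulr ?prime_gt1.
have d_dvd : d %| (d.+1 ^ k).-1 by rewrite predn_exp dvdn_mulr.
have w_gt0 : 0 < (d.+1 ^ k).-1 by rewrite predn_exp muln_gt0 d_gt0 geom_gt0.
(* With [w = (d.+1 ^ k).-1], the number is [w] times a geometric sum in [w.+1], which adds at most
   one factor [q]; [d %| w] passes the divisibility hypotheses on to [w]. *)
rewrite {1}Dj expnM -[d.+1 ^ k]prednK ?expn_gt0 // (predn_exp _ q) /=.
rewrite lognM ?geom_gt0 ?(prime_gt0 q_pr) // Dj lognM ?(prime_gt0 q_pr) //.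
rewrite (logn_prime q q_pr) eqxx addnA leq_add ?IHj //.
apply: logn_geometric_sum_le1 => // [|/q2 d4]; exact: dvdn_trans d_dvd.
Qed.

Lemma logn_fact_le q m : prime q -> logn q m`! <= m.
Proof.
move=> q_pr; rewrite logn_fact //.
(* Counting the last term twice lets the induction on the number of terms close, as
   [2 * (m %/ q ^ k.+1) <= m %/ q ^ k]. *)
suff: \sum_(1 <= k < m.+1) m %/ q ^ k + m %/ q ^ m <= m.
  by apply: leq_trans; apply: leq_addr.
elim: {1 4}m => [|k IHk]; first by rewrite big_geq // divn1.
apply: leq_trans IHk; rewrite big_nat_recr //= -addnA leq_add2l.
rewrite expnSr divnMA addnn -muln2.
by apply: leq_trans (leq_divM _ q); rewrite leq_mul2l prime_gt1 // orbT.
Qed.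

(** * Prime parts of the order of the general linear group *)

(** Only multiples [e * j] of the order [e] of [x] modulo [q] contribute, each at most
    [logn q d + logn q j] with [d = (x ^ e).-1]; the terms [logn q j] add up to the valuation of
    [(n %/ e)]!. *)
Lemma prime_part_prod_predX_le q x n : prime q -> 1 < x -> ~~ (q %| x) ->
    (q = 2 -> 4 %| x.-1) ->
  q ^ (\sum_(1 <= i < n.+1) logn q (x ^ i).-1) <= x ^ (2 * n).
Proof.
move=> q_pr x_gt1 qx q2; have x_gt0 := ltnW x_gt1.
have dvd_pred i : (q %| (x ^ i).-1) = (x ^ i == 1 %[mod q]).
  by rewrite -subn1 -eqn_mod_dvd ?expn_gt0 ?x_gt0 // eq_sym.
have [e /andP[e_gt0 qe] e_min] :
    {e | (0 < e) && (q %| (x ^ e).-1)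
       & forall i, (0 < i) && (q %| (x ^ i).-1) -> e <= i}.
  have ex_e : exists e, (0 < e) && (q %| (x ^ e).-1).
    have co_xq: coprime x q by rewrite coprime_sym prime_coprime.
    exists (totient q); rewrite totient_gt0 prime_gt0 // dvd_pred.
    by rewrite (Euler_exp_totient co_xq) eqxx.
  by case: (ex_minnP ex_e) => e; exists e.
have dvd_e i : q %| (x ^ i).-1 -> e %| i.
  have xiE : x ^ i = x ^ (i %% e) %[mod q].
    move: qe; rewrite dvd_pred => /eqP xe1.
    rewrite {1}(divn_eq i e) mulnC expnD expnM -modnMml -modnXm xe1.
    by rewrite modnXm exp1n modnMml mul1n.
  rewrite dvd_pred xiE -dvd_pred => r1.
  rewrite /dvdn; case: posnP => // r_gt0.
  by have := e_min (i %% e); rewrite r_gt0 r1 leqNgt ltn_pmod // => /(_ isT).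
have xe_gt1 : 1 < x ^ e by rewrite -(exp1n e) ltn_exp2r.
pose d := (x ^ e).-1; have d_gt0 : 0 < d by rewrite -ltnS prednK // ltnW.
have dE : d.+1 = x ^ e by rewrite prednK // ltnW.
have q2d : q = 2 -> 4 %| d.
  by move/q2 => x4; rewrite /d predn_exp dvdn_mulr.
have sum_le m : \sum_(1 <= i < m.+1) logn q (x ^ i).-1 <=
    (m %/ e) * logn q d + logn q (m %/ e)`!.
  elim: m => [|m IHm]; first by rewrite big_geq.
  rewrite big_nat_recr //= divnS //.
  have [em | em] := boolP (e %| m.+1); last first.
    rewrite add0n -[leqRHS]addn0 leq_add // leqn0.
    rewrite lognE q_pr /=; case: ifP => // /andP[_ /dvd_e].
    by rewrite (negPf em).
  rewrite add1n factS lognM ?fact_gt0 // mulSn addnACA addnC leq_add //.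
  rewrite -[in leqLHS](divnK em) mulnC expnM -dE divnS // em add1n.
  exact: logn_predX_le.
have leq_pow a b k : a <= b -> a ^ k <= b ^ k.
  by case: k => // k leab; rewrite leq_exp2r.
apply: leq_trans (leq_pexp2l (prime_gt0 q_pr) (sum_le n)) _.
(* One factor per summand: [q ^ logn q d] and [q] are both at most [d], hence below [x ^ e]. *)
apply: (@leq_trans ((x ^ e) ^ (n %/ e) * (x ^ e) ^ (n %/ e))).
  rewrite expnD leq_mul //.
    rewrite mulnC expnM leq_pow //.
    by rewrite -dE leqW // dvdn_leq // pfactor_dvdnn.
  apply: (@leq_trans (q ^ (n %/ e))).
    by rewrite leq_exp2l ?prime_gt1 // logn_fact_le.
  by rewrite leq_pow // -dE leqW // dvdn_leq.
rewrite -expnD -expnM addnn -mul2n mulnCA leq_pexp2l // leq_mul2l.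
by rewrite mulnC leq_divM.
Qed.

Lemma logn_prod_predX q x n : 1 < x ->
  logn q (\prod_(1 <= i < n.+1) (x ^ i - 1)) =
  \sum_(1 <= i < n.+1) logn q (x ^ i).-1.
Proof.
move=> x_gt1; have pos i : 0 < i -> 0 < x ^ i - 1.
  by move=> i_gt0; rewrite subn_gt0 -(exp1n i) ltn_exp2r.
elim: n => [|n IHn]; first by rewrite !big_geq // logn1.
rewrite !(big_nat_recr n.+1) //= lognM ?pos // ?IHn ?subn1 //.
by rewrite big_nat_cond; apply: prodn_cond_gt0 => i /andP[/andP[/pos]].
Qed.

(** Only the factors [#|F| ^ i - 1] of the order formula contribute. Bounding them with
    [x = #|F| ^ 2] doubles the exponent [2 * n]. *)
Lemma GL_prime_part_le (F : finFieldType) n q : 0 < n -> prime q ->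
  ~~ (q %| #|F|) -> #|'GL_n[F]%g|`_q <= #|F| ^ (4 * n).
Proof.
move=> n_gt0 q_pr qF; have F_gt1 : 1 < #|F| := finNzRing_gt1 F.
have F_gt0 := ltnW F_gt1.
rewrite p_part card_GL // lognM; last 2 first.
- by rewrite expn_gt0 F_gt0.
- rewrite big_nat_cond; apply: prodn_cond_gt0 => i /andP[/andP[i_gt0 _] _].
  by rewrite subn_gt0 -(exp1n i) ltn_exp2r.
rewrite lognX lognE (negPf qF) !andbF muln0 add0n logn_prod_predX //.
have x_gt1 : 1 < #|F| ^ 2 by rewrite -[ltnLHS](exp1n 2) ltn_exp2r.
have qx : ~~ (q %| #|F| ^ 2) by rewrite Euclid_dvdX // andbT.
apply: (@leq_trans ((#|F| ^ 2) ^ (2 * n))); last by rewrite -expnM mulnA.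
(* Passing to [#|F| ^ 2] supplies the congruence modulo 4 needed when q = 2. *)
apply: leq_trans (prime_part_prod_predX_le n q_pr x_gt1 qx _).
  rewrite leq_pexp2l ?prime_gt0 // big_nat_cond [leqRHS]big_nat_cond.
  apply: leq_sum => i /andP[/andP[i_gt0 _] _].
  rewrite dvdn_leq_log //; last by rewrite -expnM mulnC expnM (predn_exp _ 2) dvdn_mulr.
  rewrite -expnM -ltnS prednK ?expn_gt0 ?F_gt0 //.
  by rewrite -[ltnLHS](exp1n (2 * i)) ltn_exp2r ?muln_gt0.
move=> q2; move: qF; rewrite q2 dvdn2 negbK => F_odd.
have ->: (#|F| ^ 2).-1 = #|F|.-1 * #|F|.+1.
  by rewrite predn_exp big_ord_recl big_ord1 expn0 expn1 add1n.
rewrite (@dvdn_mul 2 2) // dvdn2 ?negbK /= ?F_odd //.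
by case: #|F| F_odd F_gt0 => //= m /negPf->.
Qed.

Lemma card_GL_le (F : finFieldType) n : 0 < n -> #|'GL_n[F]%g| <= #|F| ^ (n * n).
Proof.
move=> n_gt0; rewrite cardsT.
apply: leq_trans (leq_card (val : {'GL_n[F]} -> _) val_inj) _.
by rewrite card_mx prednK.
Qed.

(** * Counting elementary abelian subgroups *)

(** The order bound makes [A] generated by [n] elements, and some conjugate of [A] lies in a fixed
    Sylow subgroup [S]. So [A] is recovered from a conjugating element and an [n]-tuple in [S]. *)
Lemma card_abelem_subgroups_le (gT : finGroupType) (G : {group gT}) p n :
    prime p ->
    (forall A : {group gT}, A \subset G -> p.-abelem%g A -> #|A| <= p ^ n) ->
  #|[set A : {group gT} | (A \subset G) && p.-abelem%g A]|
    <= #|G| * (#|G|`_p) ^ n.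
Proof.
move=> p_pr rank_le; have [S sylS] := Sylow_exists p G.
pose f (u : gT * {ffun 'I_n -> gT}) : {set gT} :=
  (<<[set u.2 i | i : 'I_n]>> :^ u.1)%g.
pose D := setX G [set g : {ffun 'I_n -> gT} | g \in ffun_on (mem S)].
have cardD : #|D| = #|G| * (#|G|`_p) ^ n.
  by rewrite cardsX cardsE card_ffun_on card_ord (card_Hall sylS).
rewrite -cardD -(card_imset _ val_inj).
apply: leq_trans (leq_imset_card f D); apply/subset_leq_card/subsetP => X.
case/imsetP=> A; rewrite inE => /andP[sAG abelA] ->{X} /=.
have [x Gx sAxS] := Sylow_Jsub sylS sAG (abelem_pgroup abelA).
have abelAx : p.-abelem%g (A :^ x)%G by rewrite abelemJ.
have [T genT cardT] := grank_witness (A :^ x)%G.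
have sTS : T \subset S by apply: subset_trans sAxS; rewrite -genT subset_gen.
have leTn : #|T| <= n.
  rewrite cardT grank_abelian ?(abelem_abelian abelAx) // (rank_abelem abelAx).
  rewrite -(leq_exp2l _ _ (prime_gt1 p_pr)) -p_part part_pnat_id.
    by rewrite cardJg rank_le.
  exact: abelem_pgroup abelAx.
(* The default value 1 pads a generating set of fewer than [n] elements. *)
pose g : {ffun 'I_n -> gT} := [ffun i : 'I_n => nth 1%g (enum T) i].
apply/imsetP; exists (x^-1, g)%g.
  rewrite !inE groupV Gx /=; apply/ffun_onP => i; rewrite ffunE.
  have [lti | gei] := ltnP i (size (enum T)).
    by apply: (subsetP sTS); rewrite -mem_enum mem_nth.
  by rewrite nth_default.
rewrite /f /=; suff ->: <<[set g i | i : 'I_n]>>%g = (A :^ x)%g by rewrite conjsgK.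
apply/eqP; rewrite eqEsubset -[(A :^ x)%g]genT !gen_subG.
apply/andP; split; apply/subsetP=> y.
  case/imsetP=> i _ ->; rewrite ffunE.
  have [lti | gei] := ltnP i (size (enum T)); last by rewrite nth_default.
  by rewrite mem_gen // -mem_enum mem_nth.
move=> Ty; apply/mem_gen/imsetP.
have lty : index y (enum T) < #|T| by rewrite cardE index_mem mem_enum.
exists (Ordinal (leq_trans lty leTn)) => //.
by rewrite ffunE /= nth_index // mem_enum.
Qed.

(** * Splitting a group of the product variety *)

(** [N] is a [q]-group with quotient an [r]-group, hence a normal Hall subgroup; a complement [B] is
    isomorphic to [M / N]. *)
Lemma in_AqAr_join (q r : nat) (gT : finGroupType) (M : {group gT}) :
    prime q -> prime r -> q != r -> in_AqAr q r M ->
  exists A B : {group gT},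
    [/\ A \subset M, q.-abelem%g A, B \subset M, r.-abelem%g B & M = (A <*> B)%G].
Proof.
move=> q_pr r_pr qr /existsP[N /and5P[nNM abN expN abQ expQ]].
have abelN : q.-abelem%g N by rewrite abelemE // abN.
have abelQ : r.-abelem%g (M / N)%g by rewrite abelemE // abQ.
have hallN : Hall M N.
  rewrite /Hall normal_sub //= -card_quotient ?normal_norm //.
  apply: (@pnat_coprime q); first exact: (abelem_pgroup abelN).
  apply: sub_in_pnat (abelem_pgroup abelQ) => i _ /eqP->.
  by rewrite !inE eq_sym.
have /splitsP[B /complP[tiNB defM]] := SchurZassenhaus_split hallN nNM.
have sBM : B \subset M by rewrite -defM mulG_subr.
have nNB : B \subset 'N(N)%g by apply: subset_trans sBM (normal_norm nNM).
exists N, B; split=> //; first exact: normal_sub.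
  rewrite (isog_abelem (quotient_isog nNB tiNB)).
  exact: abelemS (quotientS _ sBM) abelQ.
by apply/val_inj; rewrite /= norm_joinEr.
Qed.

Local Open Scope ring_scope.

(** * Elementary abelian linear groups in coprime characteristic *)

(** Over the algebraic closure ['X^q - 1] is separable and kills the commuting matrices of [A], so
    they are simultaneously diagonalizable, with [q] choices for each diagonal entry. *)
Lemma abelem_GL_card_le (F : finFieldType) n q (A : {group {'GL_n[F]}}) :
  (0 < n)%N -> prime q -> ~~ (q %| #|F|)%N -> q.-abelem%g A -> (#|A| <= q ^ n)%N.
Proof.
case: n A => // n A _ q_pr qF; rewrite abelemE // => /andP[abA expA].
have [K [FtoK _]] := countable_algebraic_closure F.
have qK : q%:R != 0 :> K.
  rewrite -(rmorph_nat FtoK) fmorph_eq0; apply: contra qF => q0.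
  have q_char : q \in [pchar F] by rewrite inE q_pr.
  have F_gt1 : (1 < #|F|)%N := finNzRing_gt1 F.
  case: (logn q _) (card_pprimeChar q_char) => [F1 | k ->]; first by rewrite F1 in F_gt1.
  by rewrite expnS dvdn_mulr.
pose p : {poly K} := 'X^q - 1.
have p_monic : p \is monic by rewrite /p -polyC1 monicXnsubC // prime_gt0.
have [rs Dp] := closed_field_poly_normal p.
rewrite (monicP p_monic) scale1r in Dp.
have rs_uniq : uniq rs by rewrite -separable_prod_XsubC -Dp separable_Xn_sub_1.
have size_rs : size rs = q.
  by apply: succn_inj; rewrite -(size_prod_XsubC rs id) -Dp size_XnsubC ?prime_gt0.
pose h (a : {'GL_n.+1[F]}) : 'M[K]_n.+1 := map_mx FtoK (GLval a).
have h_inj : injective h by move=> a b /map_mx_inj eq_ab; apply: val_inj.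
have hM : {morph h : a b / (a * b)%g >-> a *m b}.
  by move=> a b; rewrite /h GL_MxE map_mxM.
have hX a : a \in A -> horner_mx (h a) p = 0.
  move=> Aa; rewrite rmorphB rmorphXn /= horner_mx_X rmorph1.
  have hXn k : h a ^+ k = h (a ^+ k)%g.
    elim: k => [|k IHk]; first by rewrite expg0 /h GL_1E map_mx1.
    by rewrite exprS expgS hM IHk.
  by rewrite hXn (exponentP expA) // /h GL_1E map_mx1 subrr.
pose hs := [seq h a | a <- enum A].
have [P Pu /allP/= diagP] : exists2 P, P \in unitmx
    & all [pred B | mxpoly.simmx_to_for P B is_diag_mx] hs.
  apply/mxpoly.codiagonalizableP; split.
    move=> _ _ /mapP[a + ->] /mapP[b + ->]; rewrite !mem_enum => Aa Ab.
    by rewrite /comm_mx -!hM (centsP abA).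
  move=> _ /mapP[a + ->]; rewrite mem_enum => Aa.
  apply/mxpoly.diagonalizableP; exists rs => //.
  by rewrite -Dp mxminpoly_min // hX.
have hd a : a \in A -> exists2 d : 'rV_n.+1,
    h a = mxpoly.conjmx (invmx P) (diag_mx d) & forall i, d 0 i \in rs.
  move=> Aa; have /diagP/(mxpoly.diagonalizable_forLR Pu)[d had] : h a \in hs.
    by rewrite map_f ?mem_enum.
  exists d => // i; rewrite -root_prod_XsubC -Dp rootE.
  have: horner_mx (diag_mx d) p = 0.
    have ->: diag_mx d = mxpoly.conjmx P (h a) by rewrite had mxpoly.conjmxVK.
    by rewrite mxpoly.conjumx // mxpoly.horner_mx_uconj // hX // mulmx0 mul0mx.
  rewrite horner_mx_diag => /matrixP/(_ i i); rewrite !mxE eqxx mulr1n.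
  by move=> ->.
have q_gt0 := prime_gt0 q_pr.
(* The diagonal becomes a function of [a], whereas [hd] only asserts that one exists. *)
pose d a := \row_i mxpoly.conjmx P (h a) i i.
have dE a : a \in A -> h a = mxpoly.conjmx (invmx P) (diag_mx (d a)).
  move=> /hd[e he _]; rewrite {1}he; congr (mxpoly.conjmx _ (diag_mx _)).
  by apply/rowP => i; rewrite mxE he mxpoly.conjmxVK // mxE eqxx mulr1n.
have d_rs a i : a \in A -> d a 0 i \in rs.
  move=> /hd[e he ers]; rewrite mxE he mxpoly.conjmxVK //.
  by rewrite mxE eqxx mulr1n.
(* Diagonal entries are encoded by their positions in [rs]; [inord] needs a successor, hence
   [q.-1.+1] for [q]. *)
pose f (a : {'GL_n.+1[F]}) : {ffun 'I_n.+1 -> 'I_q.-1.+1} :=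
  [ffun i => inord (index (d a 0 i) rs)].
have f_inj : {in A &, injective f}.
  move=> a b Aa Ab /ffunP fab; apply: h_inj; rewrite !dE //.
  congr (mxpoly.conjmx _ (diag_mx _)); apply/rowP => i.
  have lt_ind c : c \in A -> (index (d c 0%R i) rs < q.-1.+1)%N.
    by move=> Ac; rewrite prednK // -size_rs index_mem d_rs.
  have := fab i; rewrite !ffunE => /(congr1 val) /=.
  rewrite !inordK ?lt_ind // => ind_ab.
  by rewrite -[LHS](nth_index 0 (d_rs a i Aa)) ind_ab nth_index ?d_rs.
rewrite -(card_in_imset f_inj); apply: leq_trans (max_card _) _.
by rewrite card_ffun !card_ord prednK.
Qed.

(** * The bound on the number of classes *)

Lemma card_max_AqAr_classes_le (F : finFieldType) n q r :
    (0 < n)%N -> prime q -> prime r -> q != r ->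
    ~~ (q %| #|F|)%N -> ~~ (r %| #|F|)%N ->
  (#|max_AqAr_classes q r 'GL_n[F]| <= #|F| ^ (10 * (n * n)))%N.
Proof.
move=> n_gt0 q_pr r_pr qr qF rF.
pose E p := [set A : {group {'GL_n[F]}} | (A \subset 'GL_n[F]%g) && p.-abelem%g A].
have cardE p : prime p -> ~~ (p %| #|F|)%N -> (#|E p| <= #|F| ^ (5 * (n * n)))%N.
  move=> p_pr pF; apply: leq_trans (card_abelem_subgroups_le p_pr _) _.
    by move=> A _; apply: abelem_GL_card_le.
  (* The conjugating element accounts for [n * n], the [n] generators for [4 * n] each. *)
  have ->: (5 * (n * n) = n * n + 4 * n * n)%N by rewrite -mulnA -mulSn.
  rewrite expnD [(_ ^ (4 * n * n))%N]expnM leq_mul ?card_GL_le //.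
  by rewrite leq_exp2r // GL_prime_part_le.
pose join (u : {group {'GL_n[F]}} * {group {'GL_n[F]}}) := (u.1 <*> u.2)%G.
have sub : max_AqAr_classes q r 'GL_n[F] \subset
    [set ((join u : {set _}) :^: 'GL_n[F])%g | u in setX (E q) (E r)].
  apply/subsetP => _ /imsetP[M maxM ->].
  move: maxM; rewrite inE => /maxgroupp/andP[sMG /(in_AqAr_join q_pr r_pr qr)].
  case=> [A [B [sAM abelA sBM abelB defM]]]; apply/imsetP; exists (A, B).
    by rewrite !inE /= abelA abelB !(subset_trans _ sMG).
  by rewrite defM.
apply: leq_trans (subset_leq_card sub) _; apply: leq_trans (leq_imset_card _ _) _.
rewrite cardsX; apply: leq_trans (leq_mul (cardE q q_pr qF) (cardE r r_pr rF)) _.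
by rewrite -expnD -mulnDl.
Qed.

Theorem theoremD (R : realType) :
  exists b c : R,
  forall (t q r : nat), prime t -> prime q -> prime r ->
    t != q -> t != r -> q != r ->
  forall (s k : nat), (0 < k)%N -> s = (t ^ k)%N ->
  forall (F : finFieldType), #|F| = s ->
  forall alpha : nat, (1 < alpha)%N ->
    (#|max_AqAr_classes q r 'GL_alpha[F]|)%:R <=
      2 `^ ((b + c) * (alpha%:R ^+ 2 / Num.sqrt (log2 alpha%:R))
            + 5 / 6 * alpha%:R * log2 alpha%:R
            + alpha%:R * (1 + log2 6))
      * s%:R `^ ((3 + c) * alpha%:R ^+ 2) :> R.
Proof.
exists 0, 7 => t q r t_pr q_pr r_pr tq tr qr s k k_gt0 -> F cardF n n_gt1.
have charF p : prime p -> t != p -> ~~ (p %| #|F|)%N.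
  move=> p_pr; apply: contra; rewrite cardF Euclid_dvdX // => /andP[pt _].
  by rewrite eq_sym -dvdn_prime2.
have log2_ge0 x : 1 <= x -> 0 <= log2 x :> R.
  by move=> x_ge1; rewrite divr_ge0 // ln_ge0 // ler1n.
rewrite -cardF.
apply: (@le_trans _ _ (#|F|%:R `^ ((3 + 7) * n%:R ^+ 2))).
  have ->: (3 + 7) * n%:R ^+ 2 = (10 * (n * n))%:R :> R.
    by rewrite !natrM -natrD.
  rewrite powR_mulrn // -natrX ler_nat.
  by apply: card_max_AqAr_classes_le; rewrite ?charF // ltnW.
(* The power of 2 is at least 1, since every term of its exponent is nonnegative. *)
rewrite -[leLHS]mul1r ler_wpM2r ?powR_ge0 // -[leLHS](powRr0 2) ler_powR ?ler1n //.
have n_ge1 : 1 <= n%:R :> R by rewrite ler1n ltnW.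
rewrite add0r !addr_ge0 // ?mulr_ge0 ?invr_ge0 ?sqrtr_ge0 ?log2_ge0 ?exprn_ge0 //.
- exact: ln_ge0.
- by rewrite ln_ge0 ?ler1n.
- by rewrite addr_ge0 // log2_ge0 // ler1n.
Qed.
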